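(* Let $M>0$ and $b>a>0$. Set $\omega=\dfrac{a^2+b^2}{b^2-a^2}>0$ and $t=ay-bx$. Let $\Sigma$ be a Lorentzian surface with coordinates $(x,y)$ and metric $e^{f(x,y)}(dx^2-dy^2)$, and let the target be the Schwarzschild exterior $\{(R,S):R>2M\}$ with metric $$h=\left(1-\frac{2M}{R}\right)^{-1}dR^2-\left(1-\frac{2M}{R}\right)dS^2 .$$ Then, for $t_0\in\mathbb{R}$, the map $u=(R,S)$ from $\Sigma$ to the Schwarzschild exterior defined by $$S(x,y)=\omega(by-ax),$$ and $R(x,y)=R(t)$, where $R(t)$ is determined implicitly by $$R(t)+2M\log(R(t)-2M)=\omega(t-t_0),\qquad R(t)>2M,$$ is a wave map. Moreover, the implicit relation defines $R(t)$ as a smooth, strictly monotone function of $t$ on the Schwarzschild exterior region $\{R>2M\}$.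
   Context: Here $M$ is a positive real number (the mass parameter) and $f$ is a smooth real function. A smooth map $u=(R,S)$ from a surface with metric $e^{f}(dx^2-dy^2)$ to a surface with metric $A(R)dR^2-B(R)dS^2$ ($A,B$ smooth and positive) is called a wave map if it is a critical point (with respect to smooth compactly supported variations of $(R,S)$) of the energy, which up to a positive constant factor is $$E(u)=\int\Bigl(A(R)(R_x^2-R_y^2)-B(R)(S_x^2-S_y^2)\Bigr)dx\,dy;$$ here $A(R)=(1-2M/R)^{-1}$ and $B(R)=1-2M/R$. *)

(* Defs.v *)
From HB Require Import structures.
From mathcomp Require Import all_boot all_order all_algebra.
From mathcomp Require Import all_classical all_reals all_analysis.

Set Implicit Arguments.
Unset Strict Implicit.
Unset Printing Implicit Defensive.

Import Order.TTheory GRing.Theory Num.Theory.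
Import numFieldNormedType.Exports.

Local Open Scope classical_set_scope.
Local Open Scope ring_scope.

(* [D] is meant to be open and [V] finite-dimensional: then existence and
   continuity of all iterated directional derivatives is C^n-smoothness. *)
Fixpoint Cn_on (R : realType) (V : normedModType R) (n : nat)
    (D : set V) (g : V -> R) : Prop :=
  (forall p, D p -> {for p, continuous g}) /\
  if n is n'.+1 then
    forall v : V, (forall p, D p -> derivable g p v) /\ Cn_on n' D ('D_v g)
  else True.

Definition smooth_on (R : realType) (V : normedModType R)
    (D : set V) (g : V -> R) : Prop :=
  forall n, Cn_on n D g.

Definition strictly_monotone (R : realType) (g : R -> R) : Prop :=
  {homo g : s t / s < t} \/ {homo g : s t / s < t >-> t < s}.

Section WaveMap.
Variable R : realType.

Definition area : set (measurableTypeR R * measurableTypeR R) -> \bar R :=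
  (@lebesgue_measure R \x @lebesgue_measure R)%E.

(* The quadratic form dual to dx^2 - dy^2, evaluated on the differential
   of g. *)
Definition minkowski_sq (g : R * R -> R) (p : R * R) : R :=
  ('D_((1, 0) : R * R) g p) ^+ 2 - ('D_((0, 1) : R * R) g p) ^+ 2.

(* The trace of u^*(A(R) dR^2 - B(R) dS^2) with respect to the metric
   e^f (dx^2 - dy^2), times the area density e^f of that metric. *)
Definition energy_density (f : R * R -> R) (A B : R -> R)
    (Rc Sc : R * R -> R) (p : R * R) : R :=
  expR (- f p) *
    (A (Rc p) * minkowski_sq Rc p - B (Rc p) * minkowski_sq Sc p) *
  expR (f p).

(* The conformal factor drops out. *)
Lemma energy_densityE (f : R * R -> R) (A B : R -> R) (Rc Sc : R * R -> R)
    (p : R * R) :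
  energy_density f A B Rc Sc p =
  A (Rc p) * minkowski_sq Rc p - B (Rc p) * minkowski_sq Sc p.
Proof.
by rewrite /energy_density mulrAC -expRD addNr expR0 mul1r.
Qed.

Definition energy (f : R * R -> R) (A B : R -> R) (K : set (R * R))
    (Rc Sc : R * R -> R) : R :=
  (\int[area]_(p in K) energy_density f A B Rc Sc p)%R.

Definition test_function (K : set (R * R)) (phi : R * R -> R) : Prop :=
  smooth_on setT phi /\ forall p, ~ K p -> phi p = 0.

(* The map (Rc, Sc) goes from U, with metric e^f (dx^2 - dy^2), to
   {(r, s) | N r}, with metric A(r) dr^2 - B(r) ds^2; U and N are open.
   The energy over all of U may diverge, so it is taken over a compact set
   carrying the variation. On it the varied map stays in the target for small
   e, which is all that the derivative at e = 0 depends on. *)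
Definition is_wave_map (U : set (R * R)) (f : R * R -> R)
    (N : set R) (A B : R -> R) (Rc Sc : R * R -> R) : Prop :=
  [/\ smooth_on U Rc, smooth_on U Sc, (forall p, U p -> N (Rc p)) &
    forall (K : set (R * R)) (phi psi : R * R -> R),
      compact K -> K `<=` U -> test_function K phi -> test_function K psi ->
      is_derive (0 : R) 1
        (fun e : R => energy f A B K (fun p => Rc p + e * phi p)
                                     (fun p => Sc p + e * psi p)) 0].

End WaveMap.

Definition schwarzschild_exterior (R : realType) (M : R) : set R :=
  [set r | 2 * M < r].

Definition schwarzschild_A (R : realType) (M r : R) : R := (1 - 2 * M / r)^-1.

Definition schwarzschild_B (R : realType) (M r : R) : R := 1 - 2 * M / r.

Definition implicit_relation (R : realType) (M w t0 t r : R) : Prop :=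
  2 * M < r /\ r + 2 * M * ln (r - 2 * M) = w * (t - t0).

(* Main.v *)
Require Import Defs.
From HB Require Import structures.
From mathcomp Require Import all_boot all_order all_algebra.
From mathcomp Require Import all_classical all_reals all_analysis.
From mathcomp Require Import ring lra.

Set Implicit Arguments.
Unset Strict Implicit.
Unset Printing Implicit Defensive.

Import Order.TTheory GRing.Theory Num.Theory.
Import numFieldNormedType.Exports.
Local Open Scope classical_set_scope.
Local Open Scope ring_scope.

(** Write [N] for the exterior, [A = 1 / B] and [B] for the two coefficients of
    its metric. Differentiating the implicit relation gives
    [rho' = w * B (rho)], which is at once an ordinary differential equation
    that bootstraps the smoothness of [rho] and the reason why [(R, S)] is a wave
    map: in the Euler-Lagrange equations
[[
      2 ((A(R) R_x)_x - (A(R) R_y)_y) = A'(R) |dR|^2 - B'(R) |dS|^2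
          (B(R) S_x)_x - (B(R) S_y)_y = 0
]]
    the factor [A (R)] cancels the [B (R)] of [dR = w * B (R) * dt], so that
    [A(R) R_x] and [A(R) R_y] are constants. With
    [|dg|^2 = g_x^2 - g_y^2], the first right-hand side vanishes because
    [|dR|^2 = (b^2 - a^2) w^2 B^2], [|dS|^2 = - (b^2 - a^2) w^2] and
    [A' = - B' / B^2]; the second equation holds because the gradients of
    [t = a y - b x] and of [b y - a x] are orthogonal for [dx^2 - dy^2].

    The existence, uniqueness and monotonicity of [rho] come from the tortoise
    coordinate [r + 2 M ln (r - 2 M)], an increasing bijection from [N] onto the
    real line; its inverse is differentiable by the inverse function theorem
    ([is_derive_profile]), and [smooth_profile] is the bootstrap.

    What remains is the passage from the Euler-Lagrange equations to the
    vanishing of the derivative of the energy ([is_wave_map_Euler_Lagrange],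
    for any target [A dr^2 - B ds^2] with continuously differentiable [A] and
    [B]). The energy is differentiated under the integral sign
    ([is_derive_integral_compact], [is_derive_energy]); compactness of the domain
    makes the bounds uniform. By the Euler-Lagrange equations the resulting
    integrand is a combination of partial derivatives of functions supported in
    the compact set, and each of these integrates to zero by Fubini's theorem
    and the fundamental theorem of calculus ([integral_partial_derivative]). *)

(** * Directional derivatives *)

Section DirectionalDerivatives.
Context {R : realType} {V : normedModType R}.
Implicit Types (f g : V -> R) (p v : V) (l m : R).

(** Reduces a derivative along [v] to a derivative in one real variable, where
    the chain rule and the fundamental theorem of calculus are available. *)
Lemma is_derive_line f p v (t : R) l :
  is_derive (t *: v + p) v f l <-> is_derive t 1 (fun s : R => f (s *: v + p)) l.
Proof.
have E : (fun h : R => h^-1 *: ((f \o shift (t *: v + p)) (h *: v) - f (t *: v + p)))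
  = (fun h : R => h^-1 *: (((fun s : R => f (s *: v + p)) \o shift t) (h *: 1)
       - f (t *: v + p))).
  by apply/funext => h /=; rewrite addrA -scalerDl [_%:A]mulr1.
by split => -[df dfl]; split; move: df dfl; rewrite /derivable /derive E.
Qed.

Lemma is_derive_chain (A : R -> R) f p v l m :
  is_derive (f p) 1 A m -> is_derive p v f l ->
  is_derive p v (A \o f) (m * l).
Proof.
move=> dA df; have p0 : p = 0 *: v + p by rewrite scale0r add0r.
rewrite p0; apply/is_derive_line.
apply: (@is_derive1_comp _ A (fun s : R => f (s *: v + p))).
  by rewrite -p0.
by apply/is_derive_line; rewrite -p0.
Qed.

Lemma is_derive_mul f g p v l m :
  is_derive p v f l -> is_derive p v g m ->
  is_derive p v (fun q => f q * g q) (f p * m + g p * l).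
Proof. by move=> df dg; exact: is_deriveM. Qed.

Lemma is_derive_addscale f g p v l m (e : R) :
  is_derive p v f l -> is_derive p v g m ->
  is_derive p v (fun q => f q + e * g q) (l + e * m).
Proof.
by move=> df dg; apply: is_deriveD; exact: (is_deriveZ e dg).
Qed.

End DirectionalDerivatives.

Lemma is_derive_direction {R : realType} (g : R -> R) (t v l : R) :
  is_derive t 1 g l -> is_derive t v g (v * l).
Proof.
move=> [/derivable1_diffP dg <-]; split; first exact: diff_derivable.
by rewrite !deriveE // -[in LHS](mulr1 v) -[v * 1]/(v *: (1 : R)) linearZ.
Qed.

(** * Algebra of smooth functions *)

Section Smoothness.
Context {R : realType}.

Lemma Cn_onW (V : normedModType R) n (D : set V) (g : V -> R) :
  Cn_on n.+1 D g -> Cn_on n D g.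
Proof.
elim: n g => [|n IH] g [cg dg]; first by split.
by split=> // v; have [? ?] := dg v; split=> //; exact: IH.
Qed.

Lemma Cn_on_subset (V : normedModType R) n (D E : set V) (g : V -> R) :
  E `<=` D -> Cn_on n D g -> Cn_on n E g.
Proof.
move=> ED; elim: n g => [|n IH] g [cg dg]; first by split=> // p /ED/cg.
split=> [p /ED/cg //|v]; have [dv cv] := dg v.
by split=> [p /ED/dv //|]; exact: IH.
Qed.

Lemma Cn_cst (V : normedModType R) n (c : R) : Cn_on n [set: V] (cst c).
Proof.
elim: n c => [|n IH] c; split=> //.
- by move=> p _; exact: cst_continuous.
- by move=> p _; exact: cst_continuous.
- move=> v; split=> [p _|]; first exact: derivable_cst.
  by rewrite (_ : 'D_v _ = cst 0) //; apply/funext => p; rewrite derive_cst.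
Qed.

Lemma CnD (V : normedModType R) n (f g : V -> R) :
  Cn_on n [set: V] f -> Cn_on n [set: V] g -> Cn_on n [set: V] (f + g).
Proof.
elim: n f g => [|n IH] f g [cf df] [cg dg]; split=> //.
- by move=> p Dp; apply: continuousD; [exact: cf|exact: cg].
- by move=> p Dp; apply: continuousD; [exact: cf|exact: cg].
- move=> v; have [dfv cfv] := df v; have [dgv cgv] := dg v.
  split=> [p _|]; first by apply: derivableD; [exact: dfv|exact: dgv].
  rewrite (_ : 'D_v _ = 'D_v f + 'D_v g); first exact: IH.
  by apply/funext => p; rewrite deriveD//; [exact: dfv|exact: dgv].
Qed.

Lemma CnM (V : normedModType R) n (f g : V -> R) :
  Cn_on n [set: V] f -> Cn_on n [set: V] g -> Cn_on n [set: V] (f * g).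
Proof.
elim: n f g => [|n IH] f g cnf cng; have [cf df] := cnf; have [cg dg] := cng.
  by split=> // p Dp; apply: continuousM; [exact: cf|exact: cg].
split=> [p Dp|v]; first by apply: continuousM; [exact: cf|exact: cg].
have [dfv cfv] := df v; have [dgv cgv] := dg v.
split=> [p _|]; first by apply: derivableM; [exact: dfv|exact: dgv].
rewrite (_ : 'D_v _ = f * 'D_v g + g * 'D_v f).
  by apply: CnD; apply: IH => //; exact: Cn_onW.
by apply/funext => p; rewrite deriveM//; [exact: dfv|exact: dgv].
Qed.

Lemma CnV (V : normedModType R) n (f : V -> R) :
  (forall p, f p != 0) ->
  Cn_on n [set: V] f -> Cn_on n [set: V] (fun p => (f p)^-1).
Proof.
move=> f0; elim: n => [|n IH] cnf; have [cf df] := cnf.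
  by split=> // p Dp; apply: cvgV; [exact: f0|exact: cf].
split=> [p Dp|v]; first by apply: cvgV; [exact: f0|exact: cf].
have [dfv cfv] := df v.
split=> [p _|]; first by apply: derivableV => //; exact: dfv.
have cV := IH (Cn_onW cnf).
rewrite (_ : 'D_v _ =
    cst (-1) * ((fun p => (f p)^-1) * (fun p => (f p)^-1) * 'D_v f)).
  by apply: CnM; [exact: Cn_cst|do 2 apply: CnM => //].
apply/funext => p; rewrite deriveV//; last exact: dfv.
by rewrite /GRing.scale/= !fctE mulN1r -exprVn expr2 mulNr.
Qed.

Lemma Cn_id n : Cn_on n [set: R] id.
Proof.
case: n => [|n]; split=> //; try by move=> p _; exact: cvg_id.
move=> v; split=> [p _|]; first exact: derivable_id.
by rewrite (_ : 'D_v _ = cst v); [exact: Cn_cst|apply/funext => p; rewrite derive_id].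
Qed.

Section LinearPrecomposition.
Context {V W : normedModType R} (L : V -> W).
Hypothesis linL : forall (k : R) v p, L (k *: v + p) = k *: L v + L p.

Lemma derivable_linear_comp (g : W -> R) p v :
  derivable g (L p) (L v) -> derivable (g \o L) p v.
Proof.
rewrite /derivable; set F := (X in cvg (X @ _) -> _).
rewrite (_ : F = fun h => h^-1 *: (((g \o L) \o shift p) (h *: v) - (g \o L) p)) //.
by apply/funext => h; rewrite /F /= linL.
Qed.

(** The two difference quotients are the same function of the increment [h]. *)
Lemma derive_linear_comp (g : W -> R) v :
  'D_v (g \o L) = ('D_(L v) g) \o L.
Proof.
apply/funext => p; rewrite /derive /=.
by under eq_fun do rewrite linL.
Qed.

Lemma Cn_linear_comp n (g : W -> R) : continuous L ->
  Cn_on n [set: W] g -> Cn_on n [set: V] (g \o L).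
Proof.
move=> cL; elim: n g => [|n IH] g [cg dg]; split=> //.
- by move=> p _; apply: continuous_comp; [exact: cL|exact: cg].
- by move=> p _; apply: continuous_comp; [exact: cL|exact: cg].
- move=> v; have [dv cv] := dg (L v); split=> [p _|].
    by apply: derivable_linear_comp; exact: dv.
  by rewrite derive_linear_comp; exact: IH.
Qed.

End LinearPrecomposition.
End Smoothness.

(** * Borel sets and compact sets of the plane *)

Section PlaneMeasure.
Context {R : realType}.
Let plane : measurableType _ := (measurableTypeR R * measurableTypeR R)%type.
Implicit Types (K O : set (R * R)) (g : R * R -> R).

Let box (q : (rat * rat) * (rat * rat)) : set (R * R) :=
  `](ratr q.1.1 : R), ratr q.1.2[%classic `*` `](ratr q.2.1 : R), ratr q.2.2[%classic.

Lemma rat_itv_nbhs (x : R) (A : set R) : nbhs x A ->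
  exists q : rat * rat, (x \in `](ratr q.1 : R), ratr q.2[) /\
    [set` `](ratr q.1 : R), ratr q.2[] `<=` A.
Proof.
move=> /nbhs_ballP[e /= e0 eA].
have [q /itvP q1] : exists q : rat, ratr q \in `]x - e, x[.
  by apply: rat_in_itvoo; rewrite ltrBlDr ltrDl.
have [r /itvP r1] : exists q : rat, ratr q \in `]x, x + e[.
  by apply: rat_in_itvoo; rewrite ltrDl.
exists (q, r); split; first by rewrite in_itv /= q1 r1.
move=> y /= /[!in_itv]/= /andP[qy yr]; apply: eA; rewrite /ball /=.
rewrite ltr_norml; apply/andP; split.
  by rewrite ltrBrDl ltrBlDr (lt_le_trans yr) // r1.
by rewrite ltrBlDr -ltrBlDl (le_lt_trans _ qy) // q1.
Qed.

(** The product sigma-algebra is generated by rectangles, and an open set is the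
    union of the countably many rational rectangles that it contains. *)
Lemma open_measurable_plane O : open O -> measurable (O : set plane).
Proof.
move=> oO.
have -> : O = \bigcup_q (if `[< box q `<=` O >] then box q else set0).
  apply/seteqP; split=> [[x y] Oxy|p [q _]]; last by case: asboolP => [bO /bO|_ []].
  have /= := open_nbhs_nbhs (conj oO Oxy).
  move=> [[A B] /= [/rat_itv_nbhs[q [xq qA]] /rat_itv_nbhs[r [yr rB]]] AB].
  exists (q, r) => //; case: asboolP => [_|[]]; first by split.
  by move=> [x' y'] [/= x'q y'r]; apply: AB; split; [exact: qA|exact: rB].
apply: countable_bigcupT_measurable => // q; case: ifP => // _.
by apply: measurableX; exact: measurable_itv.
Qed.

Lemma closed_measurable_plane K : closed K -> measurable (K : set plane).
Proof. by move/closed_openC/open_measurable_plane/measurableC; rewrite setCK. Qed.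

Lemma compact_measurable_plane K : compact K -> measurable (K : set plane).
Proof.
by move/compact_closed => cK; apply: closed_measurable_plane; apply: cK; exact: norm_hausdorff.
Qed.

Lemma compact_subset_square K : compact K ->
  exists2 c : R, 0 < c & K `<=` `[-c, c]%classic `*` `[-c, c]%classic.
Proof.
move=> /compact_bounded[M [_ KM]]; exists (`|M| + 1); first by rewrite ltr_wpDl.
move=> [x y] /(KM _ _) H.
have {H} : `|(x, y)| <= `|M| + 1 by apply: H; rewrite ltr_pwDr // ler_norm.
rewrite prod_normE ge_max /= => /andP[hx hy].
by split; rewrite /= in_itv /= -ler_norml.
Qed.

Lemma area_compact_lty K : compact K -> (@area R K < +oo)%E.
Proof.
move=> cK; have [c c0 Kc] := compact_subset_square cK.
apply: (@le_lt_trans _ _ (@area R (`[-c, c]%classic `*` `[-c, c]%classic))).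
  apply: le_measure => //; rewrite inE; first exact: compact_measurable_plane.
  by apply: measurableX; exact: measurable_itv.
rewrite /area product_measure1E; [|exact: measurable_itv..].
by rewrite /= lebesgue_measure_itv /= lte_fin gtrN // -EFinD -EFinM ltry.
Qed.

Lemma continuous_measurable_plane K g : measurable (K : set plane) ->
  {within K, continuous g} -> measurable_fun (K : set plane) g.
Proof.
move=> mK /continuousP cg.
apply: (measurability _ (measurable_realfun.RGenOInfty.measurableE R)).
move=> _ [_ [a ->] <-].
have /open_subspaceP[V oV VK] := cg _ (interval_open (a := BRight a) (b := +oo%O) isT isT).
rewrite setIC -VK; apply: measurableI => //; exact: open_measurable_plane.
Qed.

Lemma continuous_compact_integrable_plane K g : compact K ->
  {within K, continuous g} -> (@area R).-integrable K (EFin \o g).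
Proof.
move=> cK cg; have mK := compact_measurable_plane cK.
apply: measurable_bounded_integrable => //; first exact: area_compact_lty.
  exact: continuous_measurable_plane.
have /compact_bounded[M [_ mrt]] := continuous_compact cg cK.
by exists M; split; rewrite ?num_real // => ? ? ? ?; exact: mrt.
Qed.

End PlaneMeasure.

Lemma continuous_pair (T U V : topologicalType) (f : T -> U) (g : T -> V) x :
  {for x, continuous f} -> {for x, continuous g} ->
  {for x, continuous (fun z => (f z, g z))}.
Proof.
by move=> cf cg; exact: (@cvg_pair _ _ _ _ (nbhs (f x)) (nbhs (g x))).
Qed.

(** * Integrals over compact sets of the plane *)

Section IntegralsOverCompacts.
Context {R : realType}.
Implicit Types (K U : set (R * R)).

Lemma integral_derive_bounded_support (F dF : R -> R) (c : R) :
  (forall x : R, is_derive x 1 F (dF x)) -> continuous dF ->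
  (forall x, c < `|x| -> F x = 0 /\ dF x = 0) ->
  (\int[@lebesgue_measure R]_x (dF x)%:E = 0)%E.
Proof.
move=> FdF cdF F0; pose b : R := `|c| + 1.
have cb : c < b by rewrite ltr_pwDr // ler_norm.
have b0 : 0 < b by rewrite ltr_wpDl.
have cF : continuous F.
  by move=> x; apply/differentiable_continuous/derivable1_diffP; case: (FdF x).
transitivity (\int[@lebesgue_measure R]_(x in `[(- b)%R, b]) (dF x)%:E)%E.
  rewrite [RHS]integral_mkcond; apply: eq_integral => x _; rewrite patchE.
  case: ifPn => // /negP xb; rewrite (F0 _ _).2 //; apply: (lt_le_trans cb).
  rewrite leNgt; apply/negP => /ltW; rewrite ler_norml => xb'.
  by apply: xb; rewrite inE /= in_itv.
rewrite (@continuous_FTC2 _ dF F).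
- by rewrite (F0 b _).1 ?(F0 (- b) _).1 ?subee // ?normrN gtr0_norm.
- by rewrite gtrN.
- by apply: continuous_subspaceT; exact: cdF.
- split=> [x _||]; first by case: (FdF x).
  + exact/cvg_at_right_filter/cF.
  + exact/cvg_at_left_filter/cF.
- by move=> x _; rewrite derive1E; case: (FdF x).
Qed.

(** The divergence theorem for compact support. Outside [K] the function [g]
    vanishes near every point, so ['D_v g] is continuous on the whole plane and
    zero off [K]; the integral over [K] is then an iterated integral over the
    plane, whose inner integral is zero. *)
Lemma integral_partial_derivative K U (g : R * R -> R) (v : R * R) :
  compact K -> open U -> K `<=` U ->
  v = (1, 0) \/ v = (0, 1) ->
  (forall p, U p -> derivable g p v) ->
  (forall p, U p -> {for p, continuous ('D_v g)}) ->
  (forall p, ~ K p -> g p = 0) ->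
  (\int[@area R]_(p in K) 'D_v g p)%R = 0.
Proof.
move=> cK oU KU hv dg cg g0.
have clK : closed K by apply: compact_closed => //; exact: norm_hausdorff.
have off p : ~ K p -> \forall q \near p, ~ K q.
  by move=> nKp; apply: open_nbhs_nbhs; split=> //; exact: closed_openC.
have D0 p : ~ K p -> is_derive p v g 0.
  move=> nKp; apply: (@near_eq_is_derive _ _ _ (cst 0)).
    by near=> q; rewrite g0 //; near: q; exact: off.
have Dg p : is_derive p v g ('D_v g p).
  apply: derivableP; have [/KU/dg //|/D0] := pselect (K p).
  by case.
have cDg : continuous ('D_v g).
  move=> p; have [/KU/cg //|nKp] := pselect (K p).
  rewrite /continuous_at; have [_ ->] := D0 _ nKp.
  apply: cvg_near_cst; near=> q.
  by have [|_ ->] := D0 q; first by near: q; exact: off.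
have restrictK : (EFin \o 'D_v g) \_ K = EFin \o 'D_v g.
  apply/funext => p; rewrite patchE; case: ifPn => // /negP.
  by rewrite inE /= => /D0[_ ->].
have intg : (@area R).-integrable setT (EFin \o 'D_v g).
  rewrite -restrictK; apply/(integrable_mkcond _ (compact_measurable_plane cK)).
  by apply: continuous_compact_integrable_plane => //; exact: continuous_subspaceT.
rewrite /Rintegral integral_mkcond restrictK.
have [c c0 Kc] := compact_subset_square cK.
have E (p : R * R) : c < `|p.1| \/ c < `|p.2| -> g p = 0 /\ 'D_v g p = 0.
  move=> cp; have nKp : ~ K p.
    move=> /Kc [/= ]; rewrite !in_itv /= -!ler_norml => h1 h2.
    by case: cp; rewrite ltNge ?h1 ?h2.
  by split; [exact: g0|case: (D0 _ nKp)].
case: hv => hv.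
- rewrite /area -integral21_prod_meas1 //= integral0_eq // => y _.
  apply: (@integral_derive_bounded_support (fun x => g (x, y)) (fun x => 'D_v g (x, y)) c).
  + move=> x; have := Dg (x *: v + (0, y)).
    have L s : s *: v + (0, y) = (s, y).
      rewrite hv; congr pair => /=; last by rewrite scaler0 add0r.
      by rewrite addr0 [_%:A]mulr1.
    move=> /is_derive_line; rewrite L; congr is_derive.
    by apply/funext => s; rewrite L.
  + move=> x; apply: (@continuous_comp _ _ _ (fun x => (x, y)) ('D_v g)); last exact: cDg.
    by apply: continuous_pair; [exact: cvg_id|exact: cst_continuous].
  + by move=> x cx; apply: E; left.
- rewrite /area -integral12_prod_meas1 //= integral0_eq // => x _.
  apply: (@integral_derive_bounded_support (fun y => g (x, y)) (fun y => 'D_v g (x, y)) c).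
  + move=> y; have := Dg (y *: v + (x, 0)).
    have L s : s *: v + (x, 0) = (x, s).
      rewrite hv; congr pair => /=; first by rewrite scaler0 add0r.
      by rewrite addr0 [_%:A]mulr1.
    move=> /is_derive_line; rewrite L; congr is_derive.
    by apply/funext => s; rewrite L.
  + move=> y; apply: (@continuous_comp _ _ _ (fun y => (x, y)) ('D_v g)); last exact: cDg.
    by apply: continuous_pair; [exact: cst_continuous|exact: cvg_id].
  + by move=> y cy; apply: E; right.
Unshelve. all: by end_near. Qed.

(** Differentiation under the integral sign asks for one integrable bound of
    [g e] valid for all small [e]. Joint continuity of [g] gives [|g e| <= G] near
    each [(0, p)] with the same constant [G], and compactness of [K] makes the
    range of [e] independent of [p]. *)
Lemma is_derive_integral_compact K (f g : R -> R * R -> R) : compact K ->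
  (forall p, K p -> \forall z \near ((0 : R), p),
     is_derive (z.1 : R) 1 (f ^~ z.2) (g z.1 z.2)) ->
  (forall p, K p -> {for ((0 : R), p), continuous (fun z => g z.1 z.2)}) ->
  (\forall e \near (0 : R), {within K, continuous (f e)}) ->
  is_derive (0 : R) 1 (fun e => (\int[@area R]_(p in K) f e p)%R)
    (\int[@area R]_(p in K) g 0 p)%R.
Proof.
move=> cK dfg cg cf.
have swap (p : R * R) (Q : R -> R * R -> Prop) :
    (\forall z \near ((0 : R), p), Q z.1 z.2) ->
    \forall q \near p & e \near (0 : R), Q e q.
  move=> [[A B] /= [nA nB] AB]; exists (B, A) => //= -[q e] [/= Bq Ae].
  exact: (AB (e, q)).
have cg0 : {within K, continuous (g 0)}.
  apply: continuous_in_subspaceT => p; rewrite inE => Kp.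
  apply: (@continuous_comp _ _ _ (fun p => (0 : R, p)) (fun z => g z.1 z.2)); last exact: cg.
  by apply: continuous_pair; [exact: cst_continuous|exact: cvg_id].
have [M [_ hM]] := compact_bounded (continuous_compact cg0 cK).
(* One unit above a bound of [g 0]: room for the variation of [g] in [e]. *)
pose G : R := `|M| + 1 + 1.
have gM p : K p -> `|g 0 p| <= `|M| + 1.
  by move=> Kp; apply: (hM (`|M| + 1)); [rewrite ltr_pwDr // ler_norm|exists p].
have covB : \forall e \near (0 : R), K `<=` (fun q => `|g e q| <= G).
  apply: (proj1 (compact_near_coveringP K) cK R (nbhs 0) (fun e q => `|g e q| <= G)) => p Kp.
  apply: (swap p (fun e q => `|g e q| <= G)).
  have /cvgrPdist_lt/(_ 1 ltr01) := cg p Kp.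
  apply: filter_app; near=> z => /= gz.
  rewrite -(subrK (g 0 p) (g z.1 z.2)) (le_trans (ler_normD _ _)) // addrC.
  by rewrite lerD ?gM // distrC ltW.
have covD : \forall e \near (0 : R), 
    K `<=` (fun q => is_derive (e : R) 1 (f ^~ q) (g e q)).
  apply: (proj1 (compact_near_coveringP K) cK R (nbhs 0)
    (fun e q => is_derive (e : R) 1 (f ^~ q) (g e q))) => p Kp.
  apply: (swap p (fun e q => is_derive (e : R) 1 (f ^~ q) (g e q))).
  exact: dfg.
have /nbhs_ballP[d /= d0 dP] : \forall e \near (0 : R),
    [/\ {within K, continuous (f e)}, K `<=` (fun q => `|g e q| <= G) &
        K `<=` (fun q => is_derive (e : R) 1 (f ^~ q) (g e q))].
  by near do split.
have inI e : `](- d), d[%classic e -> ball (0 : R) d e.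
  by rewrite /= in_itv /= /ball /= sub0r normrN ltr_norml.
have I0 : `](- d), d[%classic (0 : R) by rewrite /= in_itv /= oppr_lt0 d0.
have mK := compact_measurable_plane cK.
have a1 (e : R) : `](- d), d[%classic e -> (@area R).-integrable K (EFin \o f e).
  by move=> /inI/dP[ce _ _]; exact: continuous_compact_integrable_plane.
have a2 (e : R) p : `](- d), d[%classic e -> K p -> is_derive (e : R) 1 (f ^~ p) (g e p).
  by move=> /inI/dP[_ _ +] Kp => /(_ p Kp).
have pE e p : `](- d), d[%classic e -> K p -> partial1of2 f e p = g e p.
  by move=> Ie Kp; rewrite partial1of2E; case: (a2 _ _ Ie Kp).
have a3 (e : R) p : `](- d), d[%classic e -> K p -> derivable (f ^~ p) e 1.
  by move=> Ie Kp; case: (a2 _ _ Ie Kp).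
have G0 : 0 <= G by rewrite /G; do 2 apply: addr_ge0 => //.
have a4 : (@area R).-integrable K (EFin \o (fun=> G)).
  apply: continuous_compact_integrable_plane => //.
  by apply: continuous_subspaceT => ?; exact: cvg_cst.
have a5 (e : R) p : `](- d), d[%classic e -> K p -> `|partial1of2 f e p| <= G.
  by move=> Ie Kp; rewrite pE //; have /inI/dP[_ + _] := Ie; exact.
split; first exact: (derivable_under_integral mK I0 a1 a3 (fun=> G0) a4 a5).
rewrite -derive1E (differentiation_under_integral mK I0 a1 a3 (fun=> G0) a4 a5).
by apply: eq_Rintegral => p; rewrite inE => Kp; rewrite pE.
Unshelve. all: by end_near. Qed.

End IntegralsOverCompacts.

(** * The first variation of the energy *)

Section ContinuityOfSums.
Context {R : realType} {T : topologicalType}.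
Implicit Types (f g : T -> R) (x : T).

Lemma continuous_add f g x : {for x, continuous f} -> {for x, continuous g} ->
  {for x, continuous (fun z => f z + g z)}.
Proof. by move=> cf cg; exact: continuousD. Qed.

Lemma continuous_sub f g x : {for x, continuous f} -> {for x, continuous g} ->
  {for x, continuous (fun z => f z - g z)}.
Proof. by move=> cf cg; exact: continuousB. Qed.

Lemma continuous_mul f g x : {for x, continuous f} -> {for x, continuous g} ->
  {for x, continuous (fun z => f z * g z)}.
Proof. by move=> cf cg; exact: continuousM. Qed.

Lemma continuous_sqr f x : {for x, continuous f} ->
  {for x, continuous (fun z => f z ^+ 2)}.
Proof. by move=> cf; exact: continuous_mul. Qed.

End ContinuityOfSums.

Section SmoothOn.
Context {R : realType} {V : normedModType R} {D : set V}.
Implicit Types (g : V -> R) (p v : V).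

Lemma smooth_on_continuous g p : smooth_on D g -> D p -> {for p, continuous g}.
Proof. by move=> /(_ 0%N)[+ _]; exact. Qed.

Lemma smooth_on_is_derive g p v : smooth_on D g -> D p ->
  is_derive p v g ('D_v g p).
Proof. by move=> /(_ 1%N)[_ /(_ v)[dg _]] /dg/derivableP. Qed.

Lemma smooth_on_derive g v : smooth_on D g -> smooth_on D ('D_v g).
Proof. by move=> sg n; have [_ /(_ v)[]] := sg n.+1. Qed.

End SmoothOn.

Section EulerLagrange.
Context {R : realType}.
Local Notation e1 := ((1, 0) : R * R).
Local Notation e2 := ((0, 1) : R * R).
Variables (U : set (R * R)) (N : set R) (Rc Sc : R * R -> R).
Hypotheses (oU : open U) (oN : open N).
Hypotheses (sR : smooth_on U Rc) (sS : smooth_on U Sc).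
Hypothesis (RN : forall p, U p -> N (Rc p)).

Definition C1_with_derivative (C dC : R -> R) :=
  forall r, N r -> is_derive r 1 C (dC r) /\ {for r, continuous dC}.

Lemma C1_continuous C dC r : C1_with_derivative C dC -> N r ->
  {for r, continuous C}.
Proof.
by move=> hC /hC[[dC' _] _]; exact/differentiable_continuous/derivable1_diffP.
Qed.

(** The momentum along [v] of the component [T]: the Euler-Lagrange equations
    prescribe the divergence of the field of these momenta. *)
Definition current (C : R -> R) (T : R * R -> R) (v q : R * R) : R :=
  C (Rc q) * 'D_v T q.

Lemma is_derive_current (C dC : R -> R) (T : R * R -> R) v p :
  C1_with_derivative C dC -> smooth_on U T -> U p ->
  is_derive p v (current C T v)
    (C (Rc p) * 'D_v ('D_v T) p + 'D_v T p * (dC (Rc p) * 'D_v Rc p)).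
Proof.
move=> hC sT Up; apply: is_derive_mul.
  by apply: is_derive_chain; [case: (hC _ (RN Up))|exact: (smooth_on_is_derive v sR Up)].
exact: (smooth_on_is_derive v (smooth_on_derive v sT) Up).
Qed.

Lemma derive_current_test (C dC : R -> R) (T phi : R * R -> R) v p :
  C1_with_derivative C dC -> smooth_on U T -> smooth_on setT phi -> U p ->
  is_derive p v (fun q => current C T v q * phi q)
    (current C T v p * 'D_v phi p + phi p * 'D_v (current C T v) p).
Proof.
move=> hC sT sphi Up; apply: is_derive_mul; last exact: (smooth_on_is_derive v sphi I).
by apply: derivableP; have [] := is_derive_current v hC sT Up.
Qed.

(** Leibniz's rule computes the derivative on [U] only, which is enough because
    [U] is a neighbourhood of [p]. *)
Lemma continuous_derive_current_test (C dC : R -> R) (T phi : R * R -> R) v p :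
  C1_with_derivative C dC -> smooth_on U T -> smooth_on setT phi -> U p ->
  {for p, continuous ('D_v (fun q => current C T v q * phi q))}.
Proof.
move=> hC sT sphi Up.
pose h q := current C T v q * 'D_v phi q + phi q *
   (C (Rc q) * 'D_v ('D_v T) q + 'D_v T q * (dC (Rc q) * 'D_v Rc q)).
have hE q : U q -> 'D_v (fun q => current C T v q * phi q) q = h q.
  move=> Uq; have [_ ->] := derive_current_test v hC sT sphi Uq.
  by rewrite /h; have [_ ->] := is_derive_current v hC sT Uq.
have cC : {for p, continuous (fun q => C (Rc q))}.
  apply: (@continuous_comp _ _ _ Rc C); first exact: smooth_on_continuous Up.
  exact: (C1_continuous hC (RN Up)).
have cdC : {for p, continuous (fun q => dC (Rc q))}.
  apply: (@continuous_comp _ _ _ Rc dC); first exact: smooth_on_continuous Up.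
  by case: (hC _ (RN Up)).
have cDT := smooth_on_continuous (smooth_on_derive v sT) Up.
have cDDT := smooth_on_continuous (smooth_on_derive v (smooth_on_derive v sT)) Up.
have cDR := smooth_on_continuous (smooth_on_derive v sR) Up.
have cphi := smooth_on_continuous sphi (I : setT p).
have cDphi := smooth_on_continuous (smooth_on_derive v sphi) (I : setT p).
have ch : {for p, continuous h}.
  exact: (continuous_add (continuous_mul (continuous_mul cC cDT) cDphi)
    (continuous_mul cphi (continuous_add (continuous_mul cC cDDT)
      (continuous_mul cDT (continuous_mul cdC cDR))))).
rewrite /prop_for /continuous_at hE //.
apply: cvg_trans ch; apply: near_eq_cvg; near=> q.
by rewrite hE //; near: q; exact: open_nbhs_nbhs (conj oU Up).
Unshelve. all: by end_near. Qed.

Lemma integral_derive_current_test (C dC : R -> R) (T phi : R * R -> R) v K :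
  C1_with_derivative C dC -> smooth_on U T -> test_function K phi ->
  compact K -> K `<=` U -> v = e1 \/ v = e2 ->
  (@area R).-integrable K (EFin \o 'D_v (fun q => current C T v q * phi q)) /\
  (\int[@area R]_(p in K) 'D_v (fun q => current C T v q * phi q)%R p)%R = 0.
Proof.
move=> hC sT [sphi phi0] cK KU hv; split.
  apply: continuous_compact_integrable_plane => //; apply: continuous_in_subspaceT => p.
  by rewrite inE => /KU Up; exact: (continuous_derive_current_test hC sT sphi Up).
apply: integral_partial_derivative cK oU KU hv _ _ _ => p.
- by move=> Up; have [] := derive_current_test v hC sT sphi Up.
- by move=> Up; exact: (continuous_derive_current_test hC sT sphi Up).
- by move=> /phi0 ->; rewrite mulr0.
Qed.

Section FirstVariation.
Variables (A dA B dB : R -> R).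
Hypotheses (hA : C1_with_derivative A dA) (hB : C1_with_derivative B dB).
Variables (K : set (R * R)) (phi psi : R * R -> R).
Hypotheses (cK : compact K) (KU : K `<=` U).
Hypotheses (tphi : test_function K phi) (tpsi : test_function K psi).

(* [density e] and [ddensity e] are the energy density of the varied map and
   its derivative in [e], with all derivatives in the plane expanded. *)
Let varied (T eta : R * R -> R) v (e : R) p := 'D_v T p + e * 'D_v eta p.

Let density e p :=
  A (Rc p + e * phi p) * (varied Rc phi e1 e p ^+ 2 - varied Rc phi e2 e p ^+ 2) -
  B (Rc p + e * phi p) * (varied Sc psi e1 e p ^+ 2 - varied Sc psi e2 e p ^+ 2).

Let ddensity e p :=
  (A (Rc p + e * phi p) *
     (2 * (varied Rc phi e1 e p * 'D_e1 phi p - varied Rc phi e2 e p * 'D_e2 phi p)) +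
   (varied Rc phi e1 e p ^+ 2 - varied Rc phi e2 e p ^+ 2) *
     (dA (Rc p + e * phi p) * phi p)) -
  (B (Rc p + e * phi p) *
     (2 * (varied Sc psi e1 e p * 'D_e1 psi p - varied Sc psi e2 e p * 'D_e2 psi p)) +
   (varied Sc psi e1 e p ^+ 2 - varied Sc psi e2 e p ^+ 2) *
     (dB (Rc p + e * phi p) * phi p)).

Let energy_varied f (e : R) :
  energy f A B K (fun p => Rc p + e * phi p) (fun p => Sc p + e * psi p) =
  (\int[@area R]_(p in K) density e p)%R.
Proof.
apply: eq_Rintegral => p; rewrite inE => /KU Up; rewrite energy_densityE.
have E (T eta : R * R -> R) v : smooth_on U T -> smooth_on setT eta ->
    'D_v (fun q => T q + e * eta q) p = varied T eta v e p.
  move=> sT seta.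
  by have [] := is_derive_addscale e (smooth_on_is_derive v sT Up)
    (smooth_on_is_derive v seta I).
by rewrite /minkowski_sq !E //; [case: tpsi|case: tpsi|case: tphi|case: tphi].
Qed.

Let is_derive_affine (a b e : R) : is_derive e 1 (fun s => a + s * b) b.
Proof.
have := is_derive_addscale b (is_derive_cst a e 1) (is_derive_id e 1).
rewrite mulr1 add0r; congr is_derive.
by apply/funext => s; rewrite mulrC.
Qed.

Let is_derive_varied_sq (T eta : R * R -> R) p (e : R) :
  is_derive e 1 (fun s => varied T eta e1 s p ^+ 2 - varied T eta e2 s p ^+ 2)
   (2 * (varied T eta e1 e p * 'D_e1 eta p - varied T eta e2 e p * 'D_e2 eta p)).
Proof.
have sq v : is_derive e 1 (fun s => varied T eta v s p ^+ 2)
    (varied T eta v e p * 'D_v eta p + varied T eta v e p * 'D_v eta p).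
  by apply: is_derive_mul; exact: is_derive_affine.
apply: (is_derive_eq (is_deriveB (sq e1) (sq e2))).
by rewrite mulrBr !mulr_natl !mulr2n.
Qed.

Let is_derive_density p (e : R) : N (Rc p + e * phi p) ->
  is_derive e 1 (density ^~ p) (ddensity e p).
Proof.
move=> Ne.
have dC C dC : C1_with_derivative C dC ->
    is_derive e 1 (fun s => C (Rc p + s * phi p)) (dC (Rc p + e * phi p) * phi p).
  move=> /(_ _ Ne)[dCr _].
  exact: (@is_derive_chain R _ C (fun s : R => Rc p + s * phi p) e 1 _ _ dCr
    (is_derive_affine _ _ _)).
exact: (is_deriveB
  (is_derive_mul (dC _ _ hA) (is_derive_varied_sq Rc phi p e))
  (is_derive_mul (dC _ _ hB) (is_derive_varied_sq Sc psi p e))).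
Qed.

Let continuous_snd_at (h : R * R -> R) (z : R * (R * R)) :
  {for z.2, continuous h} -> {for z, continuous (fun z => h z.2)}.
Proof. by move=> ch; exact: (continuous_comp (f := snd) cvg_snd ch). Qed.

Let continuous_varied_point z : U z.2 ->
  {for z, continuous (fun z : R * (R * R) => Rc z.2 + z.1 * phi z.2)}.
Proof.
have [sphi _] := tphi => Uz; apply: continuous_add.
  exact: continuous_snd_at (smooth_on_continuous sR Uz).
apply: continuous_mul; first exact: cvg_fst.
exact: continuous_snd_at (smooth_on_continuous sphi (I : setT z.2)).
Qed.

Let continuous_varied (T eta : R * R -> R) v z :
  smooth_on U T -> smooth_on setT eta -> U z.2 ->
  {for z, continuous (fun z : R * (R * R) => varied T eta v z.1 z.2)}.
Proof.
move=> sT seta Uz; apply: continuous_add.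
  exact: continuous_snd_at (smooth_on_continuous (smooth_on_derive v sT) Uz).
apply: continuous_mul; first exact: cvg_fst.
exact: continuous_snd_at
  (smooth_on_continuous (smooth_on_derive v seta) (I : setT z.2)).
Qed.

Let continuous_densities z : U z.2 -> N (Rc z.2 + z.1 * phi z.2) ->
  {for z, continuous (fun z => density z.1 z.2)} /\
  {for z, continuous (fun z => ddensity z.1 z.2)}.
Proof.
move=> Uz Nz; have [sphi _] := tphi; have [spsi _] := tpsi.
have comp (C : R -> R) : {for Rc z.2 + z.1 * phi z.2, continuous C} ->
    {for z, continuous (fun z : R * (R * R) => C (Rc z.2 + z.1 * phi z.2))}.
  by move=> cC; exact: (continuous_comp (continuous_varied_point Uz) cC).
have cA := comp _ (C1_continuous hA Nz).
have cB := comp _ (C1_continuous hB Nz).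
have cdA := comp _ (hA Nz).2.
have cdB := comp _ (hB Nz).2.
have cR v := continuous_varied (v := v) sR sphi Uz.
have cS v := continuous_varied (v := v) sS spsi Uz.
have ctest eta : smooth_on setT eta -> {for z, continuous (fun z : R * (R * R) => eta z.2)}.
  by move=> seta; apply: continuous_snd_at; exact: smooth_on_continuous seta (I : setT z.2).
have c1 := ctest _ sphi.
have c2 v : {for z, continuous (fun z : R * (R * R) => 'D_v phi z.2)} :=
  ctest _ (smooth_on_derive v sphi).
have c3 v : {for z, continuous (fun z : R * (R * R) => 'D_v psi z.2)} :=
  ctest _ (smooth_on_derive v spsi).
have k2 : {for z, continuous (fun=> 2 : R)} by exact: cst_continuous.
have csq (T : R * R -> R) eta :
    (forall v, {for z, continuous (fun z => varied T eta v z.1 z.2)}) ->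
    {for z, continuous (fun z : R * (R * R) =>
      varied T eta e1 z.1 z.2 ^+ 2 - varied T eta e2 z.1 z.2 ^+ 2)}.
  by move=> cT; exact: (continuous_sub (continuous_sqr (cT e1)) (continuous_sqr (cT e2))).
have cdsq (T : R * R -> R) eta :
    (forall v, {for z, continuous (fun z => varied T eta v z.1 z.2)}) ->
    (forall v, {for z, continuous (fun z => 'D_v eta z.2)}) ->
    {for z, continuous (fun z : R * (R * R) =>
      2 * (varied T eta e1 z.1 z.2 * 'D_e1 eta z.2 -
           varied T eta e2 z.1 z.2 * 'D_e2 eta z.2))}.
  move=> cT ceta; exact: (continuous_mul k2 (continuous_sub
    (continuous_mul (cT e1) (ceta e1)) (continuous_mul (cT e2) (ceta e2)))).
have qR := csq _ _ cR; have qS := csq _ _ cS.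
have dqR := cdsq _ _ cR c2; have dqS := cdsq _ _ cS c3.
split; first exact: (continuous_sub (continuous_mul cA qR) (continuous_mul cB qS)).
exact: (continuous_sub
  (continuous_add (continuous_mul cA dqR) (continuous_mul qR (continuous_mul cdA c1)))
  (continuous_add (continuous_mul cB dqS) (continuous_mul qS (continuous_mul cdB c1)))).
Qed.

(** Where the uniformity of the small parameter comes from: the varied map stays
    in the target on a neighbourhood of each [(0, p)]. *)
Let near_target p : K p ->
  \forall z \near ((0 : R), p), U z.2 /\ N (Rc z.2 + z.1 * phi z.2).
Proof.
move=> /KU Up; have := @continuous_varied_point (0, p) Up.
have nN : nbhs (Rc p + 0 * phi p) N.
  by rewrite mul0r addr0; apply: open_nbhs_nbhs; split=> //; exact: RN.
move=> /(_ _ nN) nRN.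
have nU : \forall z \near ((0 : R), p), U z.2.
  exact: (@cvg_snd _ _ (nbhs (0 : R)) (nbhs p) _ _ (open_nbhs_nbhs (conj oU Up))).
by near=> z; split; [near: z|near: z].
Unshelve. all: by end_near. Qed.

Lemma is_derive_energy f :
  is_derive (0 : R) 1
    (fun e => energy f A B K (fun p => Rc p + e * phi p) (fun p => Sc p + e * psi p))
    (\int[@area R]_(p in K) (
      (A (Rc p) * (2 * ('D_e1 Rc p * 'D_e1 phi p - 'D_e2 Rc p * 'D_e2 phi p)) +
       minkowski_sq Rc p * (dA (Rc p) * phi p)) -
      (B (Rc p) * (2 * ('D_e1 Sc p * 'D_e1 psi p - 'D_e2 Sc p * 'D_e2 psi p)) +
       minkowski_sq Sc p * (dB (Rc p) * phi p))))%R.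
Proof.
have D : is_derive (0 : R) 1 (fun e => (\int[@area R]_(p in K) density e p)%R)
    (\int[@area R]_(p in K) ddensity 0 p)%R.
  apply: is_derive_integral_compact => //.
  - by move=> p Kp; apply: filterS (near_target Kp) => z [_ Nz]; exact: is_derive_density.
  - by move=> p Kp; have /nbhs_singleton[Up Np] := near_target Kp;
      case: (@continuous_densities (0, p) Up Np).
  - have near_e : \forall e \near (0 : R), K `<=` (fun q => N (Rc q + e * phi q)).
      apply: (proj1 (compact_near_coveringP K) cK R (nbhs 0)
        (fun e q => N (Rc q + e * phi q))) => p Kp.
      have [[X Y] /= [nX nY] XY] := near_target Kp.
      by exists (Y, X) => //= -[q e] [/= Yq Xe]; exact: (XY (e, q) (conj Xe Yq)).2.
    apply: filterS near_e => e eN; apply: continuous_in_subspaceT => p; rewrite inE => Kp.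
    apply: (@continuous_comp _ _ _ (fun q => (e, q)) (fun z => density z.1 z.2)).
      by apply: continuous_pair; [exact: cst_continuous|exact: cvg_id].
    by case: (@continuous_densities (e, p) (KU Kp) (eN _ Kp)).
have E : (fun e => energy f A B K (fun p => Rc p + e * phi p) (fun p => Sc p + e * psi p))
    = fun e => (\int[@area R]_(p in K) density e p)%R.
  by apply/funext => e; exact: energy_varied.
rewrite E; apply: (is_derive_eq D).
by apply: eq_Rintegral => p _; rewrite /ddensity /varied !mul0r !addr0.
Qed.

End FirstVariation.

Lemma Rintegral_combination_eq0 (K : set (R * R)) (J1 J2 J3 J4 : R * R -> R) :
  @measurable _ (measurableTypeR R * measurableTypeR R)%type K ->
  (@area R).-integrable K (EFin \o J1) -> (@area R).-integrable K (EFin \o J2) ->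
  (@area R).-integrable K (EFin \o J3) -> (@area R).-integrable K (EFin \o J4) ->
  (\int[@area R]_(p in K) J1 p = 0)%R -> (\int[@area R]_(p in K) J2 p = 0)%R ->
  (\int[@area R]_(p in K) J3 p = 0)%R -> (\int[@area R]_(p in K) J4 p = 0)%R ->
  (\int[@area R]_(p in K) (2 * ((J1 p - J2 p) - (J3 p - J4 p))) = 0)%R.
Proof.
move=> mK i1 i2 i3 i4 z1 z2 z3 z4.
have i12 : (@area R).-integrable K (EFin \o (fun p => J1 p - J2 p)).
  exact: (integrableB mK i1 i2).
have i34 : (@area R).-integrable K (EFin \o (fun p => J3 p - J4 p)).
  exact: (integrableB mK i3 i4).
have i1234 : (@area R).-integrable K (EFin \o (fun p => (J1 p - J2 p) - (J3 p - J4 p))).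
  exact: (integrableB mK i12 i34).
rewrite (RintegralZl _ mK i1234) (RintegralB mK i12 i34) (RintegralB mK i1 i2).
by rewrite (RintegralB mK i3 i4) z1 z2 z3 z4 !subr0 mulr0.
Qed.

(** Multiplying the Euler-Lagrange equations by the variations turns the first
    variation into the integral of
    [2 * (div (phi * current A) - div (psi * current B))], with [div] the
    derivative along [e1] of the first component minus the derivative along
    [e2] of the second. *)
Lemma is_wave_map_Euler_Lagrange f (A dA B dB : R -> R) :
  C1_with_derivative A dA -> C1_with_derivative B dB ->
  (forall p, U p ->
    'D_e1 (current A Rc e1) p - 'D_e2 (current A Rc e2) p =
    2^-1 * (dA (Rc p) * minkowski_sq Rc p - dB (Rc p) * minkowski_sq Sc p)) ->
  (forall p, U p ->
    'D_e1 (current B Sc e1) p - 'D_e2 (current B Sc e2) p = 0) ->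
  is_wave_map U f N A B Rc Sc.
Proof.
move=> hA hB ELR ELS; split=> // K phi psi cK KU tphi tpsi.
apply: (is_derive_eq (is_derive_energy hA hB cK KU tphi tpsi f)).
have [i1 z1] := integral_derive_current_test hA sR tphi cK KU (or_introl erefl).
have [i2 z2] := integral_derive_current_test hA sR tphi cK KU (or_intror erefl).
have [i3 z3] := integral_derive_current_test hB sS tpsi cK KU (or_introl erefl).
have [i4 z4] := integral_derive_current_test hB sS tpsi cK KU (or_intror erefl).
have mK := compact_measurable_plane cK.
rewrite -[RHS](Rintegral_combination_eq0 mK i1 i2 i3 i4 z1 z2 z3 z4).
apply: eq_Rintegral => p; rewrite inE => /KU Up.
have [sphi _] := tphi; have [spsi _] := tpsi.
have DA v := @derive_val R _ _ p v _ _ (derive_current_test v hA sR sphi Up).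
have DB v := @derive_val R _ _ p v _ _ (derive_current_test v hB sS spsi Up).
rewrite !DA !DB.
have -> : 'D_e1 (current A Rc e1) p = 'D_e2 (current A Rc e2) p +
    2^-1 * (dA (Rc p) * minkowski_sq Rc p - dB (Rc p) * minkowski_sq Sc p).
  by rewrite -ELR // addrC subrK.
have -> : 'D_e1 (current B Sc e1) p = 'D_e2 (current B Sc e2) p.
  by apply/eqP; rewrite -subr_eq0 ELS.
(* An identity of polynomials in the values at [p]: [X] and [Y] are the
   derivatives along [e2] of the second components of the two currents. *)
suff alg (al be r1 r2 s1 s2 f1 f2 q1 q2 X Y ph ps da db mR mS : R) :
  (al * (2 * (r1 * f1 - r2 * f2)) + mR * (da * ph)) -
  (be * (2 * (s1 * q1 - s2 * q2)) + mS * (db * ph)) =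
  2 * ((al * r1 * f1 + ph * (X + 2^-1 * (da * mR - db * mS)) - (al * r2 * f2 + ph * X)) -
       ((be * s1 * q1 + ps * Y) - (be * s2 * q2 + ps * Y))) by exact: alg.
by field.
Qed.

End EulerLagrange.

(** * The Schwarzschild coefficients *)

Section SchwarzschildCoefficients.
Context {R : realType}.
Variable M : R.
Hypothesis M0 : 0 < M.

Lemma exterior_gt0 r : schwarzschild_exterior M r -> 0 < r.
Proof. by move=> Nr; apply: lt_trans Nr; rewrite mulr_gt0. Qed.

Lemma schwarzschild_B_gt0 r : schwarzschild_exterior M r -> 0 < schwarzschild_B M r.
Proof.
move=> Nr; have r0 := exterior_gt0 Nr.
by rewrite /schwarzschild_B subr_gt0 ltr_pdivrMr // mul1r.
Qed.

Definition schwarzschild_dB (r : R) : R := 2 * M / r ^+ 2.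

Definition schwarzschild_dA (r : R) : R :=
  - (schwarzschild_B M r) ^- 2 * schwarzschild_dB r.

Lemma open_schwarzschild_exterior : open (schwarzschild_exterior M).
Proof. exact: open_gt. Qed.

Lemma continuous_schwarzschild_dB r : 0 < r ->
  {for r, continuous schwarzschild_dB}.
Proof.
move=> r0; apply: continuous_mul; first exact: cst_continuous.
by apply: cvgV; [rewrite expf_neq0 // gt_eqF|apply: continuous_sqr; exact: cvg_id].
Qed.

Lemma C1_schwarzschild_B :
  C1_with_derivative (schwarzschild_exterior M) (schwarzschild_B M) schwarzschild_dB.
Proof.
move=> r Nr; have r0 := exterior_gt0 Nr; have rN0 : r != 0 by rewrite gt_eqF.
split; last exact: continuous_schwarzschild_dB.
have dV := is_deriveV rN0 (is_derive_id r 1).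
have := is_derive_addscale (- (2 * M)) (is_derive_cst (1 : R) r 1) dV.
have -> : 0 + - (2 * M) * (- r ^- 2 *: 1) = schwarzschild_dB r.
  by rewrite /schwarzschild_dB /GRing.scale /=; ring.
by congr is_derive; apply/funext => s; rewrite /schwarzschild_B /=; ring.
Qed.

Lemma C1_schwarzschild_A :
  C1_with_derivative (schwarzschild_exterior M) (schwarzschild_A M) schwarzschild_dA.
Proof.
move=> r Nr; have [dB cdB] := C1_schwarzschild_B Nr.
have BN0 : schwarzschild_B M r != 0 by rewrite gt_eqF // schwarzschild_B_gt0.
split; first exact: is_deriveV BN0 dB.
apply: continuous_mul => //; apply: (@continuousN _ _ _ (fun s => schwarzschild_B M s ^- 2)).
apply: cvgV; first by rewrite expf_neq0.
apply: continuous_sqr; exact: (C1_continuous C1_schwarzschild_B Nr).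
Qed.

End SchwarzschildCoefficients.

(** * The radial profile *)

Section RadialProfile.
Context {R : realType}.
Variables (M w t0 : R).
Hypotheses (M0 : 0 < M) (w0 : 0 < w).

Definition tortoise (r : R) : R := r + 2 * M * ln (r - 2 * M).

Lemma tortoise_lt r s : 2 * M < r -> r < s -> tortoise r < tortoise s.
Proof.
move=> Nr rs; apply: ltrD => //; rewrite ltr_pM2l ?mulr_gt0 //.
by rewrite ltr_ln ?posrE ?subr_gt0 ?ltrD2r // (lt_trans Nr).
Qed.

Lemma tortoise_lt_mono r s : 2 * M < r -> 2 * M < s ->
  (tortoise r < tortoise s) = (r < s).
Proof.
move=> Nr Ns; apply/idP/idP; last exact: tortoise_lt.
apply: contraTT; rewrite -!leNgt le_eqVlt => /predU1P[->//|sr].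
exact/ltW/tortoise_lt.
Qed.

Lemma tortoise_inj r s : 2 * M < r -> 2 * M < s ->
  tortoise r = tortoise s -> r = s.
Proof.
move=> Nr Ns rs; have [rls|slr|//] := ltgtP r s.
  by have := tortoise_lt Nr rls; rewrite rs ltxx.
by have := tortoise_lt Ns slr; rewrite rs ltxx.
Qed.

(** In the variable [u = ln (r - 2 M)] the tortoise coordinate is
    [2 M + exp u + 2 M u], continuous on the whole line, so the intermediate
    value theorem applies between two explicit points. *)
Lemma tortoise_surj y : exists2 r, 2 * M < r & tortoise r = y.
Proof.
have M20 : 0 < 2 * M by rewrite mulr_gt0.
pose h (u : R) := tortoise (2 * M + expR u).
have hE u : h u = 2 * M + expR u + 2 * M * u.
  by rewrite /h /tortoise (addrC (2 * M) (expR u)) addrK expRK.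
(* [2 M k = |y| + 1 + 2 M], where the unit dominates [exp (- k)]. *)
pose k := (`|y| + 1) / (2 * M) + 1.
have k0 : 0 < k by rewrite ltr_wpDl // divr_ge0 ?addr_ge0 // ltW.
have kM : 2 * M * k = `|y| + 1 + 2 * M.
  by rewrite /k mulrDr mulr1 mulrC divfK ?gt_eqF.
have hlo : h (- k) <= y.
  rewrite hE mulrN kM.
  have : expR (- k) <= 1 by rewrite -expR0 ler_expR oppr_le0 ltW.
  by have := ler_norm (- y); rewrite normrN; lra.
have hhi : y <= h k.
  rewrite hE kM; have := expR_gt0 k; have := ler_norm y; lra.
have ch : continuous h.
  move=> u; have ck : {for u, continuous (fun=> 2 * M)} by exact: cst_continuous.
  have lin : {for u, continuous (fun u => 2 * M * u)}.
    by apply: continuous_mul => //; exact: cvg_id.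
  have -> : h = fun u => (2 * M + expR u) + 2 * M * u by apply/funext.
  exact: (continuous_add (continuous_add ck (@continuous_expR R u)) lin).
have hk : - k <= k by lra.
have [|u _ hu] := @IVT _ h (- k) k y hk (continuous_subspaceT ch).
  by rewrite ge_min le_max hlo hhi orbT.
by exists (2 * M + expR u); [rewrite ltrDl expR_gt0|].
Qed.

Lemma implicit_relation_ex_unique t : exists! r, implicit_relation M w t0 t r.
Proof.
have [r Nr hr] := tortoise_surj (w * (t - t0)).
by exists r; split=> // s [Ns hs]; apply: tortoise_inj => //; rewrite hr.
Qed.

Lemma is_derive_tortoise r : 2 * M < r ->
  is_derive r 1 tortoise (1 + 2 * M / (r - 2 * M)).
Proof.
move=> Nr; have r0 : 0 < r - 2 * M by rewrite subr_gt0.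
have dsub : is_derive r 1 (fun s : R => s - 2 * M) 1 by exact: is_derive_shift.
have dln := @is_derive_chain R _ (@ln R) (fun s : R => s - 2 * M) r 1 _ _
  (is_derive1_ln r0) dsub.
by have := is_derive_addscale (2 * M) (is_derive_id r 1) dln; rewrite mulr1.
Qed.

Variable rho : R -> R.
Hypothesis rhoP : forall t, implicit_relation M w t0 t (rho t).

Lemma profile_increasing : {homo rho : s t / s < t}.
Proof.
move=> s t st; have [Ns hs] := rhoP s; have [Nt ht] := rhoP t.
by rewrite -tortoise_lt_mono // /tortoise hs ht ltr_pM2l // ltrD2r.
Qed.

(** [rho] is the inverse of the clock [r |-> t0 + tortoise r / w], whose
    derivative is [r / (w * (r - 2 M))]. *)
Lemma is_derive_profile (t : R) :
  is_derive t 1 rho (w * schwarzschild_B M (rho t)).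
Proof.
pose clock (r : R) := t0 + w^-1 * tortoise r.
have clockP r : 2 * M < r -> implicit_relation M w t0 (clock r) r.
  by move=> Nr; split=> //; rewrite /clock (addrC t0) addrK mulrA divff ?gt_eqF // mul1r.
have rho_clock r : 2 * M < r -> rho (clock r) = r.
  move=> Nr; have [N1 h1] := rhoP (clock r); have [_ h2] := clockP _ Nr.
  by apply: tortoise_inj => //; rewrite /tortoise h1.
have [Nt ht] := rhoP t.
have clock_rho : clock (rho t) = t.
  by rewrite /clock /tortoise ht mulKf ?gt_eqF // addrC subrK.
have dclock r : 2 * M < r ->
    is_derive r 1 clock (0 + w^-1 * (1 + 2 * M / (r - 2 * M))).
  move=> Nr.
  exact: (is_derive_addscale w^-1 (is_derive_cst t0 r 1) (is_derive_tortoise Nr)).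
have nN : \forall r \near rho t, 2 * M < r.
  by apply: open_nbhs_nbhs; split=> //; exact: open_gt.
have rM0 : rho t - 2 * M != 0 by rewrite subr_eq0 gt_eqF.
have r0 : rho t != 0 by rewrite gt_eqF // (lt_trans _ Nt) // mulr_gt0.
have wN0 : w != 0 by rewrite gt_eqF.
have lE : (0 + w^-1 * (1 + 2 * M / (rho t - 2 * M)))^-1 = w * schwarzschild_B M (rho t).
  by rewrite /schwarzschild_B; field; rewrite r0 rM0 wN0.
have near_id : {near rho t, cancel clock rho}.
  by apply: filterS nN => r; exact: rho_clock.
have near_cont : {near rho t, continuous clock}.
  apply: filterS nN => r /dclock[dc _].
  exact/differentiable_continuous/derivable1_diffP.
have lN0 : 0 + w^-1 * (1 + 2 * M / (rho t - 2 * M)) != 0.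
  by rewrite -invr_eq0 lE mulf_neq0 // gt_eqF // schwarzschild_B_gt0.
by have := is_derive_inverse near_id near_cont (dclock _ Nt) lN0; rewrite clock_rho lE.
Qed.

Lemma derive_profile v : 'D_v rho = fun t => v * (w * schwarzschild_B M (rho t)).
Proof.
by apply/funext => t; have [_ ->] := is_derive_direction v (is_derive_profile t).
Qed.

(** Bootstrap: if [rho] is of class [C^n], so is [w * B (rho)], which is its
    derivative. *)
Lemma smooth_profile : smooth_on setT rho.
Proof.
have c0 t : {for t, continuous rho}.
  have [d _] := is_derive_profile t.
  exact/differentiable_continuous/derivable1_diffP.
have rN0 t : rho t != 0.
  by have [Nt _] := rhoP t; rewrite gt_eqF // (exterior_gt0 M0 Nt).
elim=> [|n IH]; split=> // v; split=> [t _|].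
  by have [] := is_derive_direction v (is_derive_profile t).
have -> : 'D_v rho = cst (v * w) * (cst 1 + cst (- (2 * M)) * (fun t => (rho t)^-1)).
  by rewrite derive_profile; apply/funext => t; rewrite !fctE /schwarzschild_B; ring.
apply: CnM; first exact: Cn_cst.
by apply: CnD; [|apply: CnM; [|exact: CnV]]; exact: Cn_cst.
Qed.

End RadialProfile.

(** * Linear forms on the plane *)

Section LinearForms.
Context {R : realType}.

Definition linear_form (c d : R) (p : R * R) : R := c * p.2 - d * p.1.

Variables (c d : R).

Lemma linear_form_linear (k : R) v p :
  linear_form c d (k *: v + p) = k *: linear_form c d v + linear_form c d p.
Proof. by rewrite /linear_form /= /GRing.scale /=; ring. Qed.

Lemma continuous_linear_form : continuous (linear_form c d).
Proof.
move=> p.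
have k (e : R) : {for p, continuous (fun=> e)} by exact: cst_continuous.
have fst_p : {for p, continuous (@fst R R)} by exact: cvg_fst.
have snd_p : {for p, continuous (@snd R R)} by exact: cvg_snd.
exact: (continuous_sub (continuous_mul (k c) snd_p) (continuous_mul (k d) fst_p)).
Qed.

Lemma smooth_linear_form_comp (g : R -> R) U :
  smooth_on setT g -> smooth_on U (g \o linear_form c d).
Proof.
move=> sg n; apply: (Cn_on_subset (D := setT)) => //.
by apply: Cn_linear_comp => //; [exact: linear_form_linear|exact: continuous_linear_form].
Qed.

End LinearForms.

(** * The Schwarzschild wave map *)

Section Schwarzschild.
Context {R : realType}.
Variables (M a b w t0 : R) (rho : R -> R).
Hypotheses (M0 : 0 < M) (w0 : 0 < w).
Hypothesis rhoP : forall t, implicit_relation M w t0 t (rho t).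

Lemma is_wave_map_profile (U : set (R * R)) f : open U ->
  is_wave_map U f
    (schwarzschild_exterior M) (schwarzschild_A M) (schwarzschild_B M)
    (fun p => rho (a * p.2 - b * p.1)) (fun p => w * (b * p.2 - a * p.1)).
Proof.
move=> oU.
have -> : (fun p : R * R => w * (b * p.2 - a * p.1)) = id \o linear_form (w * b) (w * a).
  by apply/funext => p; rewrite /linear_form /=; ring.
set Rc := (fun p : R * R => rho _); set Sc := id \o _.
have N p : schwarzschild_exterior M (Rc p) by case: (rhoP (a * p.2 - b * p.1)).
have sR : smooth_on U Rc.
  apply: (smooth_linear_form_comp a b (g := rho)). exact (smooth_profile M0 w0 rhoP).
have sS : smooth_on U Sc by apply: smooth_linear_form_comp => n; exact: Cn_id.
have DR v p : 'D_v Rc p = linear_form a b v * (w * schwarzschild_B M (Rc p)).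
  have /(congr1 (@^~ p)) := derive_linear_comp (linear_form_linear a b) rho v.
  by rewrite (derive_profile M0 w0 rhoP).
have DSE v : 'D_v Sc = cst (linear_form (w * b) (w * a) v).
  rewrite (derive_linear_comp (linear_form_linear _ _) id v).
  by apply/funext => p /=; rewrite derive_id.
have DS v p : 'D_v Sc p = linear_form (w * b) (w * a) v.
  by have /(congr1 (@^~ p)) := DSE v.
have cA := C1_schwarzschild_A M0; have cB := C1_schwarzschild_B M0.
have BN0 p : schwarzschild_B M (Rc p) != 0 by rewrite gt_eqF // schwarzschild_B_gt0.
refine (is_wave_map_Euler_Lagrange oU (@open_schwarzschild_exterior R M) sR sS
  (fun p _ => N p) f cA cB _ _).
(* [A] cancels the factor [B] of the derivative of [rho]. *)
- have current_cst v : current Rc (schwarzschild_A M) Rc v = cst (linear_form a b v * w).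
    apply/funext => p; rewrite /current DR.
    rewrite (_ : schwarzschild_A M (Rc p) = (schwarzschild_B M (Rc p))^-1) //=.
    by field; exact: BN0.
  move=> p Up; rewrite !current_cst !derive_cst subrr /minkowski_sq !DR !DS.
  by rewrite /schwarzschild_dA /linear_form /=; field; exact: BN0.
(* The two terms cancel: the gradients of [R] and [S] are orthogonal. *)
- move=> p Up.
  have D v := @derive_val R _ _ p v _ _ (is_derive_current sR (fun p _ => N p) v cB sS Up).
  by rewrite !D !DSE !DS !DR !derive_cst /linear_form /=; ring.
Qed.

End Schwarzschild.

Theorem proposition9 (R : realType) (M a b : R)
    (hM : 0 < M) (ha : 0 < a) (hab : a < b)
    (U : set (R * R)) (hU : open U)
    (f : R * R -> R) (hf : smooth_on U f) (t0 : R) :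
  let w := (a ^+ 2 + b ^+ 2) / (b ^+ 2 - a ^+ 2) in
  0 < w /\
  (forall t : R, exists! r : R, implicit_relation M w t0 t r) /\
  (forall rho : R -> R, (forall t : R, implicit_relation M w t0 t (rho t)) ->
    [/\ smooth_on setT rho,
        strictly_monotone rho &
        is_wave_map U f
          (schwarzschild_exterior M) (schwarzschild_A M) (schwarzschild_B M)
          (fun p : R * R => rho (a * p.2 - b * p.1))
          (fun p : R * R => w * (b * p.2 - a * p.1))]).
Proof.
move=> w.
have w0 : 0 < w by rewrite divr_gt0 //; nra.
split=> //; split=> [t|rho rhoP]; first exact: implicit_relation_ex_unique.
split.
- exact (smooth_profile hM w0 rhoP).
- left; exact (profile_increasing hM w0 rhoP).
- exact (is_wave_map_profile a b hM w0 rhoP f hU).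
Qed.
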